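(* Let $F$ be R. Thompson's group, given by the presentation $\langle x_0,x_1,x_2,\ldots \mid x_jx_i=x_ix_{j+1}\ (0\le i<j)\rangle$, let $\bar{x}_1=x_1x_0^{-1}$, and let $S=\{x_1,\bar{x}_1\}$, which is a generating set of $F$. Let $\mathcal{C}=C(F,S)$ be the Cayley graph of $F$ with respect to $S$. Then the density of $\mathcal{C}$ is strictly greater than $3$, that is, $\bar\delta(\mathcal{C})>3$.
   Context: Cayley graph: for a group $G$ generated by a finite set $A$, the (right) Cayley graph $C(G,A)$ has vertex set $G$ and set of oriented edges $G\times A^{\pm1}$. An edge $e=(g,a)$ has initial vertex $g$, terminal vertex $ga$, label $a$, and its inverse edge is $e^{-1}=(ga,a^{-1})$. Subgraphs are closed under taking inverse edges. Density: for a finite (nonempty) graph $\Gamma$ with vertices $v_1,\dots,v_k$, the degree $\deg_\Gamma(v)$ of a vertex $v$ is the number of oriented edges of $\Gamma$ that come out of $v$, and the density of $\Gamma$ is $\delta(\Gamma)=\frac{\deg_\Gamma(v_1)+\cdots+\deg_\Gamma(v_k)}{k}$, the average vertex degree. The density of the Cayley graph $C=C(G,A)$ is $\bar\delta(C)=\sup_\Gamma\delta(\Gamma)$, where $\Gamma$ runs over all finite (nonempty) subgraphs of $C$. *)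

(* Defs.v *)
From HB Require Import structures.
From mathcomp Require Import all_boot all_order all_algebra finmap.
From mathcomp Require Import boolp classical_sets reals ereal.

Set Implicit Arguments.
Unset Strict Implicit.
Unset Printing Implicit Defensive.

Local Open Scope group_scope.
Local Open Scope quotient_scope.

Section Presentation.
Variable X : choiceType.

(* The letter (x, false) stands for x and (x, true) for x^-1. *)
Definition word := seq (X * bool).

Definition letter_inv (l : X * bool) : X * bool := (l.1, ~~ l.2).
Definition word_inv (w : word) : word := rev (map letter_inv w).

Variable rels : word -> word -> Prop.

(* The least congruence on words containing the relations [u = v], for
   [rels u v], and the free cancellations. *)
Inductive cong : word -> word -> Prop :=
| cong_rel u v of rels u v : cong u v
| cong_cancel l : cong [:: l; letter_inv l] [::]
| cong_refl u : cong u u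
| cong_sym u v of cong u v : cong v u
| cong_trans u v w of cong u v & cong v w : cong u w
| cong_cat u u' v v' of cong u u' & cong v v' : cong (u ++ v) (u' ++ v').

Definition congb : rel word := fun u v => `[< cong u v >].

Lemma congb_refl : reflexive congb.
Proof. by move=> u; apply/asboolP; apply: cong_refl. Qed.

Lemma congb_sym : symmetric congb.
Proof. by move=> u v; apply/asboolP/asboolP; apply: cong_sym. Qed.

Lemma congb_trans : transitive congb.
Proof.
by move=> v u w /asboolP uv /asboolP vw; apply/asboolP; apply: cong_trans uv vw.
Qed.

Canonical congb_equiv := EquivRel congb congb_refl congb_sym congb_trans.

Definition presented := {eq_quot congb}.

Lemma pres_eqP u v : (\pi_presented u = \pi_presented v) <-> cong u v.
Proof.
by split=> [/eqmodP/asboolP//|uv]; apply/eqmodP; apply/asboolP.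
Qed.

Definition pres_one : presented := \pi_presented [::].
Definition pres_mul (a b : presented) : presented := \pi_presented (repr a ++ repr b).
Definition pres_inv (a : presented) : presented := \pi_presented (word_inv (repr a)).

Definition pres_gen (x : X) : presented := \pi_presented [:: (x, false)].

Lemma cong_repr u : cong (repr (\pi_presented u)) u.
Proof. by apply/pres_eqP; rewrite reprK. Qed.

Lemma pres_mulE u v :
  pres_mul (\pi_presented u) (\pi_presented v) = \pi_presented (u ++ v).
Proof. by apply/pres_eqP; apply: cong_cat; apply: cong_repr. Qed.

Lemma letter_invK : involutive letter_inv.
Proof. by case=> x b; rewrite /letter_inv /= negbK. Qed.

Lemma word_invK : involutive word_inv.
Proof.
by move=> w; rewrite /word_inv map_rev revK mapK //; apply: letter_invK.
Qed.

Lemma cong_invr w : cong (w ++ word_inv w) [::].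
Proof.
elim: w => [|l w IHw]; first exact: cong_refl.
have -> : (l :: w) ++ word_inv (l :: w) =
    [:: l] ++ (w ++ word_inv w) ++ [:: letter_inv l].
  by rewrite /word_inv /= rev_cons -cats1 !catA.
apply: cong_trans (cong_cancel l).
apply: (@cong_cat [:: l] [:: l] _ ([::] ++ [:: letter_inv l])).
  exact: cong_refl.
by apply: cong_cat => //; apply: cong_refl.
Qed.

Lemma pres_surj (a : presented) : exists u, a = \pi_presented u.
Proof. by exists (repr a); rewrite reprK. Qed.

Lemma pres_mulA : associative pres_mul.
Proof.
move=> a b c.
have [u ->] := pres_surj a; have [v ->] := pres_surj b.
have [w ->] := pres_surj c.
by rewrite !pres_mulE catA.
Qed.

Lemma pres_mul1 : left_id pres_one pres_mul.
Proof. by move=> a; have [u ->] := pres_surj a; rewrite pres_mulE. Qed.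

Lemma pres_mulr1 : right_id pres_one pres_mul.
Proof. by move=> a; have [u ->] := pres_surj a; rewrite pres_mulE cats0. Qed.

Lemma pres_invE u : pres_inv (\pi_presented u) = \pi_presented (word_inv u).
Proof.
apply/pres_eqP; set v := repr _.
have vu : cong v u by apply: cong_repr.
have: cong (word_inv v ++ v ++ word_inv u) (word_inv v ++ u ++ word_inv u).
  by do 2?[apply: cong_cat => //]; apply: cong_refl.
have l1 : cong (word_inv v ++ v ++ word_inv u) (word_inv u).
  rewrite catA -[X in cong _ X]cat0s; apply: cong_cat; last exact: cong_refl.
  by rewrite -{2}[v]word_invK; apply: cong_invr.
have l2 : cong (word_inv v ++ u ++ word_inv u) (word_inv v).
  rewrite -[X in cong _ X]cats0; apply: cong_cat; first exact: cong_refl.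
  exact: cong_invr.
move=> m; apply: cong_trans (cong_trans (cong_sym m) l1).
exact: cong_sym.
Qed.

Lemma pres_mulV : left_inverse pres_one pres_inv pres_mul.
Proof.
move=> a; have [u ->] := pres_surj a; rewrite pres_invE pres_mulE.
by apply/pres_eqP; rewrite -{2}[u]word_invK; apply: cong_invr.
Qed.

Lemma pres_mulrV : right_inverse pres_one pres_inv pres_mul.
Proof.
move=> a; have [u ->] := pres_surj a; rewrite pres_invE pres_mulE.
by apply/pres_eqP; apply: cong_invr.
Qed.

HB.instance Definition _ := Choice.on presented.
HB.instance Definition _ := isGroup.Build presented
  pres_mulA pres_mul1 pres_mulr1 pres_mulV pres_mulrV.

End Presentation.

Definition thompson_rel (u v : word nat) : Prop :=
  exists i j : nat, [/\ (i < j)%N,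
    u = [:: (j, false); (i, false)] & v = [:: (i, false); (j.+1, false)]].

Definition thompsonF : groupType := presented thompson_rel.

Definition xF (i : nat) : thompsonF := pres_gen thompson_rel i.

Definition xbar1 : thompsonF := xF 1 * (xF 0)^-1.

Definition generates (G : groupType) (A : {fset G}) : Prop :=
  forall H : {pred G}, group_closed H -> {subset A <= H} ->
  forall g : G, g \in H.

Record graph := Graph {
  vertex : choiceType;
  edge : choiceType;
  ini : edge -> vertex;
  ter : edge -> vertex;
  einv : edge -> edge;
  einvK : involutive einv;
  ini_inv : forall e, ini (einv e) = ter e }.

Record finsubgraph (C : graph) := FinSubgraph {
  subV : {fset vertex C};
  subE : {fset edge C};
  subE_inv : forall e, e \in subE -> einv e \in subE;
  subE_ini : forall e, e \in subE -> ini e \in subV;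
  subE_ter : forall e, e \in subE -> ter e \in subV }.

Definition degree (C : graph) (Gam : finsubgraph C) (v : vertex C) : nat :=
  #|` [fset e in subE Gam | ini e == v]%fset |.

Definition density (R : realType) (C : graph) (Gam : finsubgraph C) : R :=
  ((\sum_(v <- subV Gam) degree Gam v)%N%:R / #|` subV Gam|%:R)%R.

Definition graph_density (R : realType) (C : graph) : \bar R :=
  ereal_sup [set (density R Gam)%:E |
    Gam in [set Gam : finsubgraph C | subV Gam != fset0]]%classic.

Section Cayley.
Variables (G : groupType) (A : {fset G}).

(* The alphabet A^{+-1}, as a set of elements of G. *)
Definition symset : {fset G} := (A `|` [fset a^-1 | a in A])%fset.

Lemma symsetV a : a \in symset -> a^-1 \in symset.
Proof.
rewrite !inE => /orP[Aa|/imfsetP[b /= Ab ->]]; last by rewrite invgK Ab.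
by apply/orP; right; apply/imfsetP; exists a.
Qed.

Definition label_inv (a : symset) : symset := [` symsetV (fsvalP a)]%fset.

Definition cayley_ini (e : G * symset) : G := e.1.
Definition cayley_ter (e : G * symset) : G := e.1 * val e.2.
Definition cayley_inv (e : G * symset) : G * symset :=
  (e.1 * val e.2, label_inv e.2).

Lemma cayley_invK : involutive cayley_inv.
Proof.
case=> g a; rewrite /cayley_inv /=; congr pair; first by rewrite mulgK.
by apply: val_inj; rewrite /= invgK.
Qed.

Lemma cayley_ini_inv e : cayley_ini (cayley_inv e) = cayley_ter e.
Proof. by []. Qed.

Definition cayley_graph : graph := Graph cayley_invK cayley_ini_inv.

End Cayley.

(* Main.v *)
(** Take the forests of binary trees of height at most [k], with a marked tree
having fewer than [N] trees on each side.  Right multiplication by [x_1]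
(resp. [xbar_1]) removes the root of the marked tree and marks its left
(resp. right) subtree, so the average degree is about [4] times the proportion
of forests whose marked tree is not a leaf.  Weigh a forest with [n] leaves by
[x^n], where [x] is chosen so that the trees of height at most [k] have total
weight [1].  As [k] grows, [x] tends to [1/4], the weight of a marked leaf, and
this density tends to [3].  But a marked leaf whose two neighbours both have
height [k] is an isolated vertex, since a merge would exceed the height bound.
Trees of height exactly [k] keep a weight of about [1 - sqrt (3/4)], so removing
these vertices raises the limit density above [3].  As edges preserve the number
of leaves, some level set [n] already has density greater than [3]. *)

Require Import Defs.
From HB Require Import structures.
From mathcomp Require Import all_boot all_order all_algebra finmap.
From mathcomp Require Import boolp classical_sets reals ereal.
From mathcomp Require Import zify lra.

Set Implicit Arguments.
Unset Strict Implicit.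
Unset Printing Implicit Defensive.

Import Order.TTheory GRing.Theory Num.Theory.

Local Open Scope group_scope.

(** * A right action of $F$, used to tell its elements apart *)

(* F acts on pairs (index of a tree, branch of that tree), the branch being read
   off the binary digits of a natural number, lowest digit first; x_i splits the
   tree i into its two halves. *)
Definition split_at (i : nat) (p : nat * nat) : nat * nat :=
  if p.1 < i then p
  else if p.1 == i then (i + odd p.2, p.2./2) else (p.1.+1, p.2).

Definition merge_at (i : nat) (p : nat * nat) : nat * nat :=
  if p.1 < i then p
  else if p.1 <= i.+1 then (i, (p.1 == i.+1) + p.2.*2) else (p.1.-1, p.2).

Lemma split_atK i : cancel (split_at i) (merge_at i).
Proof.
case=> j m; rewrite /split_at /merge_at.
case: (ltngtP j i) => [ji|ij|->] /=; first by rewrite ji.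
  by rewrite !ifF //; lia.
rewrite ltnNge leq_addr /= -[i.+1]addn1 leq_add2l leq_b1 eqn_add2l.
by rewrite eqb1 odd_double_half.
Qed.

Lemma merge_atK i : cancel (merge_at i) (split_at i).
Proof.
case=> j m; rewrite /split_at /merge_at.
case: (ltnP j i) => [-> //|ij]; case: (leqP j i.+1) => [ji|ij1] /=.
  rewrite ltnn eqxx oddD odd_double addbF oddb half_bit_double; congr pair.
  by case: eqP; lia.
by rewrite !ifF ?prednK //=; lia.
Qed.

Definition act_letter (p : nat * nat) (l : nat * bool) : nat * nat :=
  if l.2 then merge_at l.1 p else split_at l.1 p.

Lemma cong_act u v :
  cong thompson_rel u v -> foldl act_letter ^~ u =1 foldl act_letter ^~ v.
Proof.
elim=> {u v} [u v [i [j [ij -> ->]]] [a m]|[i b] p|//|u v _ uv p|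
  u v w _ uv _ vw p|u u' v v' _ uu' _ vv' p] /=.
- rewrite /act_letter /= /split_at /=.
  by repeat (case: ifP => //=); move=> *; (congr pair; lia) || lia.
- by case: b; rewrite /act_letter /= ?merge_atK ?split_atK.
- by rewrite uv.
- by rewrite uv vw.
- by rewrite !foldl_cat uu' vv'.
Qed.

Definition act (g : thompsonF) (p : nat * nat) : nat * nat :=
  foldl act_letter p (repr g).

Lemma act_pi u p : act (\pi_(presented thompson_rel) u)%qT p = foldl act_letter p u.
Proof. exact/cong_act/cong_repr. Qed.

Lemma actM g h p : act (g * h) p = act h (act g p).
Proof.
have [u ->] := pres_surj g; have [v ->] := pres_surj h.
by rewrite [_ * _]pres_mulE !act_pi foldl_cat.
Qed.

Lemma act1 p : act 1 p = p.
Proof. exact: (act_pi [::]). Qed.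

Lemma act_xF i p : act (xF i) p = split_at i p.
Proof. by rewrite act_pi. Qed.

Lemma act_xFV i p : act (xF i)^-1 p = merge_at i p.
Proof. by rewrite -{1}(merge_atK i p) -act_xF -actM mulgV act1. Qed.

Lemma act_inj g : injective (act g).
Proof. by apply: (can_inj (g := act g^-1)) => p; rewrite -actM mulgV act1. Qed.

(** * Relations and generators of $F$ *)

Lemma xF_rel i j : i < j -> xF j * xF i = xF i * xF j.+1.
Proof.
move=> ij; rewrite /xF /pres_gen ![_ * _]pres_mulE; apply/pres_eqP.
by apply: cong_rel; exists i, j.
Qed.

Lemma presented_ind (X : choiceType) (rels : word X -> word X -> Prop)
    (H : {pred presented rels}) :
  group_closed H -> (forall x, pres_gen rels x \in H) -> forall g, g \in H.
Proof.
move=> Hc Hx g; have [u ->] := pres_surj g.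
elim: u => [|[x b] u IHu]; first exact: Hc.1.
rewrite -cat1s -pres_mulE; apply: (group_closedM Hc) => //.
case: b; last exact: Hx.
by rewrite -[[:: _]]/(word_inv [:: (x, false)]) -pres_invE; apply/(group_closedV Hc)/Hx.
Qed.

Lemma generates_S : generates [fset xF 1; xbar1]%fset.
Proof.
move=> H Hc SH; have [HV HM] := (group_closedV Hc, group_closedM Hc).
have H1 : xF 1 \in H by apply: SH; rewrite !inE eqxx.
have H0 : xF 0 \in H.
  have -> : xF 0 = xbar1^-1 * xF 1 by rewrite /xbar1 invgM invgK mulgVK.
  by apply: HM => //; apply/HV/SH; rewrite !inE eqxx orbT.
apply: presented_ind => //; elim=> [//|[//|i] IHi].
have -> : pres_gen thompson_rel i.+2 = (xF 0)^-1 * (xF i.+1 * xF 0).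
  by rewrite xF_rel // mulKg.
by apply: (HM) => //; [apply: HV|apply: HM].
Qed.

(** This carries [xF 1] past the powers of [(xF 0)^-1] that record the position of the mark. *)
Lemma xF_conj a : xF a.+1 * (xF 0)^-1 ^+ a = (xF 0)^-1 ^+ a * xF 1.
Proof.
elim: a => [|a IHa]; first by rewrite mulg1 mul1g.
rewrite expgS -mulgA -IHa !mulgA; congr (_ * _).
by apply: (mulIg (xF 0)); rewrite mulgVK -mulgA xF_rel // mulKg.
Qed.

(** * Binary trees and forests as elements of $F$ *)

Inductive btree := Leaf | Node of btree & btree.

Fixpoint btree_code (t : btree) : GenTree.tree unit :=
  if t is Node a b then GenTree.Node 0 [:: btree_code a; btree_code b]
  else GenTree.Leaf tt.

Fixpoint btree_decode (c : GenTree.tree unit) : btree :=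
  if c is GenTree.Node _ [:: a; b] then Node (btree_decode a) (btree_decode b)
  else Leaf.

Lemma btree_codeK : cancel btree_code btree_decode.
Proof. by elim=> //= a -> b ->. Qed.

HB.instance Definition _ := Choice.copy btree (can_type btree_codeK).

Fixpoint leaves (t : btree) : nat :=
  if t is Node a b then leaves a + leaves b else 1%N.

Lemma leaves_gt0 t : 0 < leaves t.
Proof. by elim: t => //= a a0 b _; rewrite addn_gt0 a0. Qed.

Fixpoint height (t : btree) : nat :=
  if t is Node a b then (maxn (height a) (height b)).+1 else 0.

(** Right halves are expanded before left ones, so no split shifts the index of a tree still to be
    split. *)
Fixpoint tree_elt (i : nat) (t : btree) : thompsonF :=
  if t is Node a b then xF i * tree_elt i.+1 b * tree_elt i a else 1.

(* The trees of the forest have indices i, i + 1, ..., and the elements [xF j]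
   split the tree j when read from left to right. *)
Fixpoint forest_elt (i : nat) (f : seq btree) : thompsonF :=
  if f is t :: f' then forest_elt i.+1 f' * tree_elt i t else 1.

Lemma tree_elt_xF i j t :
  i < j -> tree_elt j t * xF i = xF i * tree_elt j.+1 t.
Proof.
elim: t j => [|a IHa b IHb] j ij /=; first by rewrite mul1g mulg1.
by rewrite -mulgA IHa // -!mulgA (mulgA _ (xF i)) IHb ?(leqW ij)// !mulgA xF_rel.
Qed.

Lemma forest_elt_xF i j f :
  i < j -> forest_elt j f * xF i = xF i * forest_elt j.+1 f.
Proof.
elim: f j => [|t f IHf] j ij /=; first by rewrite mul1g mulg1.
by rewrite -mulgA tree_elt_xF // mulgA IHf ?(leqW ij)// -mulgA.
Qed.

(** The root can be split first: the splits of [h] move past it with their indices raised by one,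
    and those of [f] come after it anyway. *)
Lemma forest_elt_node i f a b h :
  forest_elt i (f ++ Node a b :: h) =
  xF (i + size f) * forest_elt i (f ++ a :: b :: h).
Proof.
elim: f i => [|t f IHf] i /=; last by rewrite IHf addSnnS !mulgA.
by rewrite addn0 !mulgA forest_elt_xF // !mulgA.
Qed.

Lemma act_tree_lt i t j m : j < i -> act (tree_elt i t) (j, m) = (j, m).
Proof.
elim: t i => [|a IHa b IHb] i ji /=; first exact: act1.
by rewrite !actM act_xF /split_at /= ji IHb ?(leqW ji) ?IHa.
Qed.

Lemma act_tree_ge i t p : p.1 <= (act (tree_elt i t) p).1.
Proof.
elim: t i p => [|a IHa b IHb] i p /=; first by rewrite act1.
rewrite !actM act_xF; apply: leq_trans (IHa _ _); apply: leq_trans (IHb _ _).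
by rewrite /split_at; case: ifP => //= _; case: eqP => /= [->|]; lia.
Qed.

Lemma act_forest_lt i f j m : j < i -> act (forest_elt i f) (j, m) = (j, m).
Proof.
elim: f i => [|t f IHf] i ji /=; first exact: act1.
by rewrite !actM IHf ?(leqW ji) // act_tree_lt.
Qed.

Lemma tree_elt_inj i t u :
  (forall m, act (tree_elt i t) (i, m) = act (tree_elt i u) (i, m)) -> t = u.
Proof.
(* Branch 1 turns right at the root and so leaves tree [k], whereas a leaf fixes it. *)
have node_gt k a b : k < (act (tree_elt k (Node a b)) (k, 1%N)).1.
  rewrite /= !actM act_xF; apply: leq_trans (act_tree_ge _ _ _).
  apply: leq_trans (act_tree_ge _ _ _).
  by rewrite /split_at /= ltnn eqxx /= addn1.
elim: t u i => [|a IHa b IHb] [|c d] i E //.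
- by have := node_gt i c d; rewrite -E act1 ltnn.
- by have := node_gt i a b; rewrite E act1 ltnn.
(* Even branches enter the left subtree; the odd ones used below enter the right subtree. *)
have ac : a = c.
  apply: (IHa _ i) => m; have := E m.*2; rewrite /= !actM act_xF /split_at /=.
  by rewrite ltnn eqxx odd_double doubleK addn0 !(act_tree_lt _ _ (ltnSn i)).
rewrite -ac in E *; congr Node; apply: (IHb _ i.+1) => m.
apply: (@act_inj (tree_elt i a)); have := E m.*2.+1.
rewrite /= !actM act_xF /split_at /= ltnn eqxx odd_double addn1.
by rewrite uphalf_double.
Qed.

(** The factors of later trees fix tree [i], so branches of tree [i] detect the first tree alone.
    Trailing leaves do not change the element, hence the condition on the number of leaves. *)
Lemma forest_elt_inj i f h :
  sumn (map leaves f) = sumn (map leaves h) ->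
  forest_elt i f = forest_elt i h -> f = h.
Proof.
elim: f h i => [|t f IHf] [|u h] i //=.
- by have := leaves_gt0 u; lia.
- by have := leaves_gt0 t; lia.
move=> n_eq E.
have tu : t = u.
  apply: (@tree_elt_inj i) => m; have := congr1 (act ^~ (i, m)) E.
  by rewrite !actM !(act_forest_lt _ _ (ltnSn i)).
rewrite -tu in n_eq E *; congr cons; apply: (IHf _ i.+1); first by lia.
exact: mulIg E.
Qed.

(** * Forests with a marked tree as vertices of the Cayley graph *)

(* [(l, t, r)] is the forest with marked tree [t]; [l] lists the trees on its left
   starting from the nearest one. *)
Definition zipper := (seq btree * btree * seq btree)%type.

Definition zforest (z : zipper) : seq btree := catrev z.1.1 (z.1.2 :: z.2).

Definition zleaves (z : zipper) : nat := sumn (map leaves (zforest z)).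

(** The inverse merges the forest, whose trees start at index 1. Each [(xF 0)^-1] then absorbs a
    tree on the left of the mark into the spare tree 0, until the marked tree has index 1, where
    [xF 1] splits it. *)
Definition zelt (z : zipper) : thompsonF :=
  (forest_elt 1 (zforest z))^-1 * (xF 0)^-1 ^+ size z.1.1.

(* The forest word fixes tree 0, so the action on (0, 1) reads off the position
   of the marked tree in [zelt]. *)
Lemma act_x0V a m : act ((xF 0)^-1 ^+ a) (0, m) = (0, 2 ^ a * m)%N.
Proof.
elim: a m => [|a IHa] m; first by rewrite act1 mul1n.
by rewrite expgS actM act_xFV /merge_at /= add0n IHa expnSr -mulnA mul2n.
Qed.

Lemma actV_fix g p : act g p = p -> act g^-1 p = p.
Proof. by move=> gp; apply: (@act_inj g); rewrite -actM mulVg act1. Qed.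

Lemma zelt_inj z z' : zleaves z = zleaves z' -> zelt z = zelt z' -> z = z'.
Proof.
move=> n_eq E.
have size_eq : size z.1.1 = size z'.1.1.
  have := congr1 (act ^~ (0, 1%N)) E; rewrite !actM !actV_fix ?act_forest_lt //.
  by rewrite !act_x0V !muln1 => -[/eqP]; rewrite eqn_exp2l // => /eqP.
have {}E : zforest z = zforest z'.
  apply: (@forest_elt_inj 1) => //; move: E; rewrite /zelt size_eq.
  by move/mulIg/invg_inj.
case: z z' size_eq E {n_eq} => [[l t] r] [[l' t'] r'] /= size_eq.
rewrite /zforest !catrevE /= => /eqP; rewrite eqseq_cat ?size_rev //.
by case/andP=> /eqP/(can_inj revK) -> /eqP [-> ->].
Qed.

Lemma zelt_x1 l a b r : zelt (l, Node a b, r) * xF 1 = zelt (l, a, b :: r).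
Proof.
rewrite /zelt /zforest !catrevE forest_elt_node invgM /= size_rev add1n.
by rewrite -!mulgA -xF_conj mulKg.
Qed.

Lemma zelt_xbar1 l a b r : zelt (l, Node a b, r) * xbar1 = zelt (a :: l, b, r).
Proof.
by rewrite /xbar1 mulgA zelt_x1 /zelt /= expgSr mulgA.
Qed.

(** * Lower bounds for the density of a Cayley graph *)

Lemma sum_degree (C : graph) (Gam : finsubgraph C) :
  (\sum_(v <- subV Gam) degree Gam v)%N = #|` subE Gam|.
Proof.
transitivity (\sum_(v <- subV Gam) \sum_(e <- subE Gam) (ini e == v))%N.
  by apply: eq_bigr => v _; rewrite /degree card_fset_sum1 -big_fset_condE big_mkcond.
rewrite exchange_big /= card_fset_sum1 big_seq [RHS]big_seq.
apply: eq_bigr => e /subE_ini eV; rewrite (big_fsetD1 _ eV) /= eqxx big1_fset //.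
by move=> v; rewrite !inE eq_sym => /andP[/negPf ->].
Qed.

(** In the subgraph induced on [V], each [g] in [E] accounts for four oriented edges: those leaving
    it with labels [a] and [b], and their inverses or other edges ending at [g] with inverse
    labels. *)
Lemma cayley_density_ge (R : realType) (G : groupType) (a b : G)
    (V E : {fset G}) :
  uniq [:: a; b; a^-1; b^-1] -> V != fset0 -> (E `<=` V)%fset ->
  {in E, forall g, (g * a \in V) && (g * b \in V)} ->
  (((4 * #|` E|)%:R / #|` V|%:R)%R%:E
     <= graph_density R (cayley_graph [fset a; b]%fset))%E.
Proof.
set S := [fset a; b]%fset => uniqS V0 EV EaV.
pose edges := [seq e <- [seq (g, s) | g <- V, s <- enum {: symset S}] |
  cayley_ter e \in V].
have mem_edges e : (e \in edges) = (cayley_ini e \in V) && (cayley_ter e \in V).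
  rewrite mem_filter andbC; congr andb; case: e => g s.
  apply/allpairsP/idP => [[[h t] /= [hV _ [-> _]]] //|gV].
  by exists (g, s); rewrite mem_enum.
pose subE := seq_fset tt edges.
have mem_subE e : (e \in subE) = (cayley_ini e \in V) && (cayley_ter e \in V).
  by rewrite seq_fsetE mem_edges.
have subEV e : e \in subE -> cayley_inv e \in subE.
  by rewrite !mem_subE -[in X in _ -> X](cayley_ini_inv (cayley_inv e))
    cayley_invK cayley_ini_inv andbC.
pose Gam := @FinSubgraph (cayley_graph S) V subE subEV
  (fun e eE => proj1 (andP (etrans (esym (mem_subE e)) eE)))
  (fun e eE => proj2 (andP (etrans (esym (mem_subE e)) eE))).
apply: le_trans (ereal_sup_ubound _); last by exists Gam.
rewrite lee_fin /density sum_degree ler_wpM2r ?invr_ge0 ?ler0n // ler_nat.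
(* The edge with label [s] charged to [g] leaves [g] if [s] is a generator and ends at [g]
   otherwise; [s] and its initial vertex determine [g]. *)
pose place g (s : symset S) := if \val s \in [:: a; b] then g else g * (\val s)^-1.
pose halves := [seq (place g s, s) | g <- E, s <- enum {: symset S}].
have uniq_halves : uniq halves.
  apply: allpairs_uniq; [exact: fset_uniq|exact: enum_uniq|].
  move=> [g s] [h t] _ _ /= [+ st]; rewrite -{t}st /place.
  by case: ifP => _ => [->|/mulIg ->].
have card_S : 4 <= #|` symset S|.
  apply: (uniq_leq_size uniqS) => x; rewrite /symset !inE.
  case/or4P => /eqP->; rewrite ?eqxx ?orbT //; apply/orP; right; apply/imfsetP.
    by exists a; rewrite // !inE eqxx.
  by exists b; rewrite // !inE eqxx orbT.
apply: (@leq_trans (size halves)).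
  by rewrite size_allpairs -cardE -cardfE mulnC leq_mul2l card_S orbT.
apply: uniq_leq_size => // e /allpairsP [[g s] /= [gE _ ->]].
have /andP[ga gb] := EaV g gE; have gV := fsubsetP EV g gE.
rewrite mem_subE /cayley_ini /cayley_ter /place /=.
have := fsvalP s; rewrite /symset; case: ifP => [+ _|+ /fsetUP[]/=].
- by rewrite !inE => /orP[] /eqP->; rewrite gV.
- by rewrite !inE => ->.
rewrite mulgVK gV andbT => _ /imfsetP[c /=].
by rewrite !inE => /orP[] /eqP-> ->; rewrite invgK.
Qed.

Local Open Scope ring_scope.

(** * The generating function of trees of bounded height *)

Fixpoint tree_gf (R : pzSemiRingType) (x : R) (k : nat) : R :=
  if k is k'.+1 then x + tree_gf x k' ^+ 2 else x.

Lemma tree_gf_root (R : rcfType) k : exists2 x : R, 0 <= x & tree_gf x k = 1.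
Proof.
(* Running the recursion at ['X] gives a polynomial, so the intermediate value theorem applies on
   $[0,1]$. *)
pose p := tree_gf ('X : {poly R}) k - 1.
have pE x : p.[x] = tree_gf x k - 1.
  rewrite /p hornerD hornerN hornerC; congr (_ - _).
  by elim: k {p} => [|k IHk] /=; rewrite ?hornerE ?IHk.
have gf0 : tree_gf (0 : R) k = 0 by elim: k {p pE} => //= k ->; rewrite expr0n addr0.
have gf1 : 1 <= tree_gf (1 : R) k.
  by elim: k {p pE gf0} => //= k IHk; rewrite lerDl sqr_ge0.
have [|x /andP[x0 _]] := @poly_ivt _ p 0 1 ler01.
  by rewrite !pE gf0 sub0r oppr_le0 ler01 subr_ge0.
by rewrite /root pE subr_eq0 => /eqP; exists x.
Qed.

(* Below 1/4 the iteration stays under the fixed point of [g = x + g ^ 2]. *)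
Lemma tree_gf_root_ge (R : realFieldType) (x : R) k :
  0 <= x -> tree_gf x k = 1 -> 1 / 4 <= x.
Proof.
move=> x0 gf1; rewrite leNgt; apply/negP => x4.
have: 0 <= tree_gf x k <= 1 / 2.
  elim: k {gf1} => [|k IHk] /=; first by lra.
  move/andP: IHk => [g0 g2]; rewrite addr_ge0 ?sqr_ge0 //=.
  have : 0 <= tree_gf x k * (1 / 2 - tree_gf x k) by rewrite mulr_ge0 // subr_ge0.
  by rewrite expr2; nra.
by rewrite gf1; lra.
Qed.

(* Each step of the iteration gains [x - 1/4 + (g - 1/2) ^ 2]. *)
Lemma tree_gf_root_le (R : realFieldType) (x : R) k :
  tree_gf x k = 1 -> k%:R * (x - 1 / 4) <= 1 - x.
Proof.
move=> gf1; rewrite -[X in _ <= X - x]gf1.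
elim: k {gf1} => [|k IHk] /=; first by rewrite mul0r subrr.
have := sqr_ge0 (tree_gf x k - 1 / 2); rewrite -[k.+1%:R]natr1; nra.
Qed.

(** * Enumeration and weights of trees, forests and zippers *)

Fixpoint trees (k : nat) : seq btree :=
  if k is k'.+1 then Leaf :: [seq Node a b | a <- trees k', b <- trees k']
  else [:: Leaf].

Lemma mem_trees t k : (t \in trees k) = (height t <= k)%N.
Proof.
elim: k t => [|k IHk] [|a b] //=.
rewrite inE /= ltnS geq_max -!IHk; apply/allpairsP/andP.
  by move=> [[c d] /= [? ? [-> ->]]].
by move=> [ha hb]; exists (a, b).
Qed.

Lemma trees_uniq k : uniq (trees k).
Proof.
elim: k => //= k IHk; apply/andP; split; first by apply/allpairsP => -[[? ?] []].
by apply: allpairs_uniq => // -[a b] [c d] _ _ [-> ->].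
Qed.

Lemma sum_trees (R : comPzRingType) (x : R) k :
  \sum_(t <- trees k) x ^+ leaves t = tree_gf x k.
Proof.
elim: k => [|k IHk] /=; first by rewrite big_seq1.
rewrite big_cons big_allpairs_dep /= expr1 -IHk expr2 mulr_suml; congr (_ + _).
by apply: eq_bigr => a _; rewrite mulr_sumr; apply: eq_bigr => b _; rewrite exprD.
Qed.

Lemma sum_trees_top (R : comPzRingType) (x : R) k :
  \sum_(t <- trees k.+1 | height t == k.+1) x ^+ leaves t =
  tree_gf x k.+1 - tree_gf x k.
Proof.
rewrite -!sum_trees [in RHS](bigID (fun t => height t == k.+1)).
rewrite [X in _ + X - _](_ : _ = \sum_(t <- trees k) x ^+ leaves t) ?addrK //.
rewrite -big_filter; apply: perm_big; apply: uniq_perm.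
- by rewrite filter_uniq ?trees_uniq.
- exact: trees_uniq.
by move=> t; rewrite mem_filter !mem_trees; lia.
Qed.

Fixpoint forests (k N : nat) : seq (seq btree) :=
  if N is N'.+1 then [::] :: [seq t :: f | t <- trees k, f <- forests k N']
  else [::].

Lemma mem_forests f k N :
  (f \in forests k N) = (size f < N)%N && all (fun t => height t <= k)%N f.
Proof.
elim: N f => [|N IHN] [|t f] //=.
rewrite inE /= ltnS andbCA -IHN -mem_trees; apply/allpairsP/andP.
  by move=> [[c d] /= [? ? [-> ->]]].
by move=> [ht hf]; exists (t, f).
Qed.

Lemma forests_uniq k N : uniq (forests k N).
Proof.
elim: N => //= N IHN; apply/andP; split; first by apply/allpairsP => -[[? ?] []].
by apply: allpairs_uniq; rewrite ?trees_uniq // => -[a b] [c d] _ _ [-> ->].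
Qed.

Definition forest_leaves (f : seq btree) : nat := sumn (map leaves f).

(** Forests of each fixed length have total weight a power of [tree_gf x k], that is 1. *)
Lemma sum_forests (R : comPzRingType) (x : R) k N :
  tree_gf x k = 1 -> \sum_(f <- forests k N) x ^+ forest_leaves f = N%:R.
Proof.
move=> gf1; elim: N => [|N IHN] /=; first by rewrite big_nil.
rewrite big_cons big_allpairs_dep /= expr0 -natr1 addrC; congr (_ + _).
rewrite -[RHS]mul1r -[X in _ = X * _]gf1 -sum_trees -IHN mulr_suml.
apply: eq_bigr => t _; rewrite mulr_sumr.
by apply: eq_bigr => f _; rewrite -exprD.
Qed.

(** Both side lists of a zipper start with the neighbour of the marked tree. *)
Definition topped (k : nat) (f : seq btree) : bool :=
  if f is t :: _ then height t == k else false.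

Lemma sum_forests_topped (R : comPzRingType) (x : R) k N :
  tree_gf x k.+1 = 1 ->
  \sum_(f <- forests k.+1 N.+1 | topped k.+1 f) x ^+ forest_leaves f =
  (1 - tree_gf x k) * N%:R.
Proof.
move=> gf1; rewrite -[X in X - _]gf1 -sum_trees_top.
move: k.+1 gf1 => {}k gf1 /=; rewrite big_mkcond big_cons big_allpairs_dep /=.
rewrite add0r -(sum_forests N gf1) mulr_suml [RHS]big_mkcond.
apply: eq_bigr => t _; rewrite -big_mkcond /=; case: ifP => _; last by rewrite big_pred0.
by rewrite mulr_sumr; apply: eq_bigr => f _; rewrite -exprD.
Qed.

Definition zippers (k N : nat) : seq zipper :=
  [seq (lt, r) | lt <- [seq (l, t) | l <- forests k N, t <- trees k],
                 r <- forests k N].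

Lemma mem_zippers z k N :
  (z \in zippers k N) =
  [&& z.1.1 \in forests k N, z.1.2 \in trees k & z.2 \in forests k N].
Proof.
case: z => [[l t] r] /=; apply/allpairsP/and3P.
  by case=> [[lt r']] /= [/allpairsP[[l' t'] /= [? ? ->]]] ? [-> -> ->].
by case=> hl ht hr; exists (l, t, r); split=> //=; apply/allpairsP; exists (l, t).
Qed.

Lemma zippers_uniq k N : uniq (zippers k N).
Proof.
apply: allpairs_uniq; rewrite ?forests_uniq //; last by move=> [? ?] [? ?] _ _ [-> ->].
by apply: allpairs_uniq; rewrite ?forests_uniq ?trees_uniq // => -[? ?] [? ?] _ _ [-> ->].
Qed.

Lemma zleavesE z :
  zleaves z = (forest_leaves z.1.1 + leaves z.1.2 + forest_leaves z.2)%N.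
Proof.
by rewrite /zleaves /zforest catrevE map_cat map_rev sumn_cat sumn_rev /= addnA.
Qed.

Lemma sum_zippers (R : comPzRingType) (x : R) k N
    (p q : pred (seq btree)) (o : pred btree) :
  \sum_(z <- zippers k N | [&& p z.1.1, o z.1.2 & q z.2]) x ^+ zleaves z =
  (\sum_(f <- forests k N | p f) x ^+ forest_leaves f) *
  (\sum_(t <- trees k | o t) x ^+ leaves t) *
  (\sum_(f <- forests k N | q f) x ^+ forest_leaves f).
Proof.
rewrite big_mkcond /zippers !big_allpairs_dep /= !mulr_suml [RHS]big_mkcond.
apply: eq_bigr => l _; case: (p l) => /=; last by rewrite big1 // => t _; rewrite big1.
rewrite [X in _ = X * _]mulr_sumr mulr_suml [RHS]big_mkcond; apply: eq_bigr => t _.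
case: (o t) => /=; last by rewrite big1.
rewrite mulr_sumr [RHS]big_mkcond; apply: eq_bigr => r _.
by case: (q r) => //; rewrite zleavesE !exprD.
Qed.

Lemma sum_leaf (R : comPzRingType) (x : R) k :
  \sum_(t <- trees k | t == Leaf) x ^+ leaves t = x.
Proof.
have leaf_k : Leaf \in trees k by rewrite mem_trees.
by rewrite big_mkcond (bigD1_seq Leaf) ?trees_uniq //= expr1 big1 ?addr0 // => t /negPf ->.
Qed.

(** * Isolated vertices, level sets and the gap in weight *)

Definition isolated (k : nat) (z : zipper) : bool :=
  [&& topped k z.1.1, z.1.2 == Leaf & topped k z.2].

Lemma sum_levels (R : comPzRingType) (T : Type) (w : T -> nat) (x : R) B s :
  all (fun t => w t < B)%N s ->
  \sum_(t <- s) x ^+ w t = \sum_(n < B) x ^+ n * (count (fun t => w t == n) s)%:R.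
Proof.
elim: s => [_|t s IHs /= /andP[tB /IHs IH]].
  by rewrite big_nil big1 // => n _; rewrite mulr0.
rewrite big_cons IH (bigD1 (Ordinal tB)) //= [in RHS](bigD1 (Ordinal tB)) //=.
rewrite eqxx natrD mulrDr mulr1 -!addrA; congr (_ + (_ + _)).
apply: eq_bigr => n nt; rewrite -[w t == n]/(Ordinal tB == n :> nat).
by rewrite val_eqE eq_sym (negPf nt).
Qed.

(** If the inequality failed on every level, summing with the nonnegative weights [x ^+ n] would
    contradict the hypothesis. *)
Lemma exists_level (R : realDomainType) (T : Type) (w : T -> nat) (x : R)
    (a b : nat) (s t : seq T) :
  0 <= x ->
  a%:R * (\sum_(u <- s) x ^+ w u) < b%:R * (\sum_(u <- t) x ^+ w u) ->
  exists n, (a * count (fun u => w u == n) s < b * count (fun u => w u == n) t)%N.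
Proof.
move=> x0; apply: contraPP => /forallNP no_n; apply/negP; rewrite -leNgt.
pose B := (\max_(u <- s ++ t) w u).+1.
have /andP[sB tB] : all (fun u => w u < B)%N s && all (fun u => w u < B)%N t.
  rewrite -all_cat /B; elim: (s ++ t) => //= u r IHr.
  rewrite big_cons ltnS leq_maxl /=; apply: sub_all IHr => v vr.
  by apply: leq_trans vr _; rewrite ltnS leq_maxr.
rewrite (sum_levels x sB) (sum_levels x tB) !mulr_sumr; apply: ler_sum => n _.
rewrite !(mulrCA _%:R) -!natrM ler_wpM2l ?exprn_ge0 // ler_nat leqNgt.
exact/negP/no_n.
Qed.

(* [g] is the weight of the trees of height less than k, and [1 - g] that of the
   trees of height k. *)
Lemma weighted_gap (R : realFieldType) (x g N : R) :
  1 / 4 <= x -> 1000 * (x - 1 / 4) <= 1 - x -> x + g ^+ 2 = 1 -> 1000 <= N ->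
  3 * ((N + 1) ^+ 2 - x * ((1 - g) * N) ^+ 2) < 4 * ((1 - x) * N ^+ 2).
Proof.
move=> x_ge x_le gE N_ge.
(* Here [g ^+ 2 = 1 - x] is at most 3/4, which is less than 49/64. *)
have g_le : g <= 7 / 8 by rewrite leNgt; apply/negP => g_gt; nra.
have h2 : 1 / 64 <= (1 - g) ^+ 2 by nra.
have xh : 1 / 256 <= x * (1 - g) ^+ 2 by nra.
have N2 : 1000 * N <= N ^+ 2 by nra.
have xhN : 1 / 256 * N ^+ 2 <= x * (1 - g) ^+ 2 * N ^+ 2.
  by rewrite ler_wpM2r ?sqr_ge0.
have xN : (3 / 4 - 3 / 4000) * N ^+ 2 <= (1 - x) * N ^+ 2.
  by rewrite ler_wpM2r ?sqr_ge0 //; lra.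
have -> : x * ((1 - g) * N) ^+ 2 = x * (1 - g) ^+ 2 * N ^+ 2 by rewrite exprMn mulrA.
have -> : (N + 1) ^+ 2 = N ^+ 2 + 2 * N + 1 by rewrite sqrrD1 mulr_natl.
(* In units of [N ^+ 2], the isolated vertices gain 3/256, while the error in [x] costs 3/1000 and
   the boundary terms about 6/1000. *)
move: xhN xN N2; set u := _ * N ^+ 2; set v := (1 - x) * _; set M := N ^+ 2.
lra.
Qed.

(** The bound [N.+1] leaves room for the tree that a split adds to one side of the mark. *)
Definition full_zippers (k N : nat) : seq zipper :=
  [seq z <- zippers k N.+1 | ~~ isolated k z].

Definition open_zippers (k N : nat) : seq zipper :=
  [seq z <- zippers k N | z.1.2 != Leaf].

Lemma big_predC (V : zmodType) (I : Type) (s : seq I) (P : pred I) (F : I -> V) :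
  \sum_(i <- s | ~~ P i) F i = \sum_(i <- s) F i - \sum_(i <- s | P i) F i.
Proof. by rewrite [X in X - _](bigID P) /= addrAC subrr add0r. Qed.

Lemma zipper_gap (R : rcfType) (k N : nat) :
  (1000 <= k)%N -> (1000 <= N)%N ->
  exists n, (3 * count (fun z => zleaves z == n) (full_zippers k N)
    < 4 * count (fun z => zleaves z == n) (open_zippers k N))%N.
Proof.
case: k => // k k_ge N_ge; have [x x0 gf1] := tree_gf_root R k.+1.
apply: (@exists_level R _ zleaves x) => //; rewrite !big_filter.
have sumT M : \sum_(z <- zippers k.+1 M) x ^+ zleaves z = M%:R ^+ 2.
  move: k.+1 gf1 {k_ge} => K gf1; have := sum_zippers x K M xpredT xpredT xpredT.
  by rewrite /= sum_trees gf1 mulr1 (sum_forests _ gf1).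
have -> : \sum_(z <- zippers k.+1 N.+1 | ~~ isolated k.+1 z) x ^+ zleaves z =
    (N%:R + 1) ^+ 2 - x * ((1 - tree_gf x k) * N%:R) ^+ 2.
  rewrite big_predC sumT natr1; congr (_ - _).
  rewrite (sum_zippers x _ _ (topped k.+1) (topped k.+1) (pred1 Leaf)).
  by rewrite (sum_forests_topped _ gf1) sum_leaf mulrAC -expr2 mulrC.
have -> : \sum_(z <- zippers k.+1 N | z.1.2 != Leaf) x ^+ zleaves z =
    (1 - x) * N%:R ^+ 2.
  rewrite big_predC sumT mulrBl mul1r; congr (_ - _).
  move: k.+1 gf1 {k_ge} => K gf1; have := sum_zippers x K N xpredT xpredT (pred1 Leaf).
  rewrite /= sum_leaf (sum_forests _ gf1) mulrAC -expr2 mulrC => <-.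
  by apply: eq_bigl => z; rewrite andbT.
have x4 := tree_gf_root_ge x0 gf1.
apply: weighted_gap => //; last by rewrite (ler_nat R 1000).
apply: le_trans (tree_gf_root_le gf1); rewrite ler_wpM2r ?subr_ge0 //.
by rewrite (ler_nat R 1000).
Qed.

(** The split zippers are not isolated: the half next to the mark has height below [k]. *)
Lemma open_zipperP k N n z :
  z \in open_zippers k N -> zleaves z = n ->
  exists l a b r, let full z' := z' \in full_zippers k N /\ zleaves z' = n in
    [/\ z = (l, Node a b, r), full z, full (l, a, b :: r) & full (a :: l, b, r)].
Proof.
rewrite mem_filter mem_zippers; case: z => [[l [//|a b]] r] /= + zn.
rewrite !mem_forests mem_trees /= => /and3P[/andP[lN lk] abk /andP[rN rk]].
exists l, a, b, r; rewrite /= !mem_filter !mem_zippers !mem_forests !mem_trees /=.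
rewrite -zn !zleavesE /forest_leaves /= lk rk /isolated /= !andbF /=.
split=> //; split; lia.
Qed.

(** * The density exceeds 3 *)

Theorem theorem1 (R : realType) :
  let S : {fset thompsonF} := [fset xF 1; xbar1]%fset in
  generates S /\ (3%:R%:E < graph_density R (cayley_graph S))%E.
Proof.
move=> S; split; first exact: generates_S.
have [k k_ge] : exists k, (1000 <= k)%N by exists 1000%N.
have [n gap] := zipper_gap R k_ge k_ge.
(* Fixing the number of leaves makes [zelt] injective, so counts of zippers become cardinalities in
   $F$. *)
pose level s := [seq z <- s | zleaves z == n].
have level_inj s : {in level s &, injective zelt}.
  move=> z y; rewrite !mem_filter => /andP[/eqP zn _] /andP[/eqP yn _].
  by apply: zelt_inj; rewrite zn yn.
pose image s := seq_fset tt (map zelt (level s)).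
have card_image s : uniq s -> #|` image s| = count (fun z => zleaves z == n) s.
  move=> s_uniq; rewrite size_seq_fset undup_id ?size_map ?size_filter //.
  by rewrite map_inj_in_uniq ?filter_uniq //; apply: level_inj.
have mem_image s z : z \in s /\ zleaves z = n -> zelt z \in image s.
  by case=> zs zn; rewrite seq_fsetE map_f // mem_filter zn eqxx.
pose V := image (full_zippers k k); pose E := image (open_zippers k k).
have EP g : g \in E -> exists l a b r, let inV z := zelt z \in V in
    [/\ g = zelt (l, Node a b, r), inV (l, Node a b, r), inV (l, a, b :: r) &
        inV (a :: l, b, r)].
  rewrite seq_fsetE => /mapP[z]; rewrite mem_filter => /andP[/eqP zn zs] ->.
  have [l [a [b [r [-> *]]]]] := open_zipperP zs zn.
  by exists l, a, b, r; split=> //; apply: mem_image.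
have {gap} gap : (3 * #|` V| < 4 * #|` E|)%N.
  by rewrite !card_image ?filter_uniq ?zippers_uniq.
have EV : (E `<=` V)%fset by apply/fsubsetP => g /EP[l [a [b [r [-> ]]]]].
have V0 : V != fset0.
  rewrite -cardfs_gt0; have := fsubset_leq_card EV; lia.
(* The images of two points already separate the four labels. *)
have xF_uniq : uniq [:: xF 1; xbar1; (xF 1)^-1; xbar1^-1]%g.
  apply: (@map_uniq _ _ (fun g => (act g (0, 1), act g (1, 1))%N)).
  by rewrite /= /xbar1 invgM invgK !actM !act_xF !act_xFV.
apply: lt_le_trans (cayley_density_ge R xF_uniq V0 EV _); last first.
  by move=> g /EP[l [a [b [r [-> _ ? ?]]]]]; rewrite zelt_x1 zelt_xbar1; apply/andP.
by rewrite lte_fin ltr_pdivlMr ?ltr0n ?cardfs_gt0 // -natrM ltr_nat.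
Qed.
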